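(* Let $\mathcal{D}=(\Delta_0\times\Delta_1,\mathcal{B})$ be the design constructed (as described in the context) from a resolvable $2$-$(v_0,k_0,\lambda_0)$ design $\mathcal{D}_0$ with $r$ parallel classes of $s$ blocks each, a symmetric $2$-$(v_1,r,\lambda_1)$ design $\mathcal{D}_1$, a family of bijections $(\psi_\beta)_{\beta\in\mathcal{L}_1}$, and a transversal design $\mathcal{D}_2$ with block size $k_2$, with $b_2$ blocks, with $r_2$ blocks on each point and with $\lambda_2$ blocks on any two points from different groups. Then: (a) $\mathcal{D}$ is a $1$-$(v_0v_1,\,k_0k_2,\,rr_2)$ design with $v_1b_2$ blocks. (b) $\mathcal{D}$ is symmetric (that is, it has equally many points and blocks) if and only if $$r(r-1)s\lambda_2=k_0k_2(k_2-1).$$ (c) $\mathcal{D}$ is a $2$-design if and only if $$\lambda_1=\lambda_0\frac{(r-1)s}{k_2-1},$$ and in this case it is a $2$-$(v_0v_1,\,k_0k_2,\,\lambda_1\lambda_2)$ design.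
   Context: Input data: 1. $\mathcal{D}_0=(\Delta_0,\mathcal{L}_0)$ is a resolvable $2$-$(v_0,k_0,\lambda_0)$ design: its block set $\mathcal{L}_0$ is partitioned into a set $\mathcal{P}_0=\{P_1,\dots,P_r\}$ of $r$ parallel classes, each $P_i$ consisting of $s$ blocks that partition the point set $\Delta_0$. So $v_0=sk_0$ and $(v_0-1)\lambda_0=r(k_0-1)$. 2. $\mathcal{D}_1=(\Delta_1,\mathcal{L}_1)$ is a symmetric $2$-$(v_1,r,\lambda_1)$ design (blocks of size $r$; degenerate cases such as the $2$-$(v_1,v_1-1,v_1-2)$ design are allowed), so $(v_1-1)\lambda_1=r(r-1)$; together with bijections $\psi_\beta:\mathcal{P}_0\to\beta$ for $\beta\in\mathcal{L}_1$, such that for each $P\in\mathcal{P}_0$ and $i\in\Delta_1$ there is a unique $\beta\in\mathcal{L}_1$ with $\psi_\beta(P)=i$. 3. $\mathcal{D}_2=(\Delta_2,\mathcal{L}_2)$ is a transversal design: its point set is $\Delta_2=\bigcup_{P\in\mathcal{P}_0}P$ $(=\mathcal{L}_0)$, partitioned into $r$ ''groups'' of size $s$, namely the parallel classes $P\in\mathcal{P}_0$; each block has size $k_2\le r$ and meets each group in at most one point; and any two points in different groups lie in exactly $\lambda_2$ blocks. There are $b_2$ blocks and each point lies in $r_2$ blocks, where $$r_2=\frac{(r-1)s\lambda_2}{k_2-1},\qquad b_2=\frac{r(r-1)s^2\lambda_2}{k_2(k_2-1)}.$$ Construction: for $\gamma\in\mathcal{L}_2$, $\beta\in\mathcal{L}_1$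 and $j\in\beta$, the intersection $\gamma\cap\psi_\beta^{-1}(j)$ is either empty or a single block of the parallel class $\psi_\beta^{-1}(j)$; in the latter case it is identified with that block, regarded as a subset of $\Delta_0$. Put $$B_\beta(\gamma):=\bigcup_{j\in\beta}\big((\gamma\cap\psi_\beta^{-1}(j))\times\{j\}\big)\subseteq\Delta_0\times\Delta_1 .$$ The design $\mathcal{D}=(\Delta_0\times\Delta_1,\mathcal{B})$ has point set $\Delta_0\times\Delta_1$ and block set $\mathcal{B}$ equal to the disjoint union over $\beta\in\mathcal{L}_1$ of the sets $\mathcal{B}_\beta=\{B_\beta(\gamma)\mid\gamma\in\mathcal{L}_2\}$. *)

(* Defs.v *)
From mathcomp Require Import all_boot all_order all_algebra.

Set Implicit Arguments.
Unset Strict Implicit.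
Unset Printing Implicit Defensive.

(* A design is a pair (X, L): a finite set X of points and a set L of subsets
   of X (no repeated blocks). *)
Section Designs.
Variable T : finType.
Implicit Types (X B C P : {set T}) (L G : {set {set T}}).

(* (X, L) is a t-(v, k, lam) design; the usual conventions t <= k <= v and
   lam > 0 are part of the definition. *)
Definition is_design (t v k lam : nat) X L : Prop :=
  [/\ #|X| = v,
      t <= k <= v,
      0 < lam,
      forall B, B \in L -> B \subset X /\ #|B| = k
    & forall S : {set T}, S \subset X -> #|S| = t ->
        #|[set B in L | S \subset B]| = lam].

Definition is_2design X L : Prop :=
  exists v k lam : nat, is_design 2 v k lam X L.

Definition symmetric_design X L : Prop := #|L| = #|X|.

(* PP is a set of r parallel classes, each of s blocks, partitioning L. *)
Definition is_resolution (r s : nat) X L (PP : {set {set {set T}}}) : Prop :=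
  [/\ partition PP L,
      #|PP| = r
    & forall P : {set {set T}}, P \in PP -> partition P X /\ #|P| = s].

(* (X, L) is a transversal design with group set G.  The bound 1 < k is what
   makes the replication number (r - 1) s lam / (k - 1) meaningful. *)
Definition is_transversal_design (r s k lam : nat) X G L : Prop :=
  [/\ [/\ partition G X, #|G| = r & forall P, P \in G -> #|P| = s],
      1 < k <= r,
      0 < lam,
      forall C, C \in L ->
        [/\ C \subset X, #|C| = k & forall P, P \in G -> #|C :&: P| <= 1]
    & forall P Q x y, P \in G -> Q \in G -> P != Q -> x \in P -> y \in Q ->
        #|[set C in L | (x \in C) && (y \in C)]| = lam].

End Designs.

Section Construction.
Variables T0 T1 : finType.
Variables (L0 : {set {set T0}}) (PP0 : {set {set {set T0}}}).
Variable L1 : {set {set T1}}.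
Variable psi : {set T1} -> {set {set T0}} -> T1.
Variable L2 : {set {set {set T0}}}.

(* psi beta is only relevant for beta in L1, and only on PP0. *)
Definition is_bijection_family : Prop :=
  (forall beta : {set T1}, beta \in L1 ->
     {in PP0 &, injective (psi beta)} /\ psi beta @: PP0 = beta) /\
  (forall (P : {set {set T0}}) (i : T1), P \in PP0 ->
     exists! beta : {set T1}, beta \in L1 /\ psi beta P = i).

(* P ranges over the (unique) class psi_beta^-1(j).  As gamma meets P in at
   most one element, cover (gamma :&: P) is that element, viewed as a subset
   of T0, or the empty set. *)
Definition new_block (beta : {set T1}) (gamma : {set {set T0}})
    : {set T0 * T1} :=
  \bigcup_(j in beta) \bigcup_(P in PP0 | psi beta P == j)
    setX (cover (gamma :&: P)) [set j].

Definition new_blocks : {set {set T0 * T1}} :=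
  \bigcup_(beta in L1) [set new_block beta gamma | gamma in L2].

End Construction.

(* Main.v *)
(* A block [new_block beta gamma] meets the slice over [psi beta P] in the
   element of [gamma] lying in [P], if any.  Such an element determines its
   class [P], and [P] together with [psi beta P] determines [beta]; so the
   blocks are indexed faithfully by the pairs [(beta, gamma)].
   Counting pairs then gives:
   - through a point [(x, i)]: one [beta] per class [P], namely the one with
     [psi beta P = i], and [r2] choices of [gamma] through the block of [P] on
     [x], so [r * r2] in total;
   - through [(x, i)] and [(y, i)] with [x <> y]: as [gamma] meets [P] at most
     once, only the [lam0] classes with [x] and [y] in a common block contribute,
     so [lam0 * r2];
   - through [(x, i)] and [(y, j)] with [i <> j]: [lam1] choices of [beta], then
     two elements of distinct classes to be covered by [gamma], so
     [lam1 * lam2].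
   Since [r2 * (k2 - 1) = (r - 1) * s * lam2], the last two numbers agree exactly
   under the condition in (c). *)
Require Import Defs.
From mathcomp Require Import all_boot all_order all_algebra.
From mathcomp Require Import zify ring.

Set Implicit Arguments.
Unset Strict Implicit.
Unset Printing Implicit Defensive.

(** * Preliminaries on counting and partitions *)

Lemma card_set_sum (T : finType) (A : {set T}) (p : pred T) :
  #|[set x in A | p x]| = \sum_(x in A) (p x : nat).
Proof.
rewrite -sum1_card big_mkcond [RHS]big_mkcond; apply: eq_bigr => x _.
by rewrite inE; case: (x \in A); case: (p x).
Qed.

Lemma partition_pblock (T : finType) (P : {set {set T}}) (D B : {set T}) x :
  partition P D -> B \in P -> x \in B -> pblock P x = B.
Proof. by case/and3P=> _ tP _; apply: def_pblock. Qed.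

Lemma partition_pblock_mem (T : finType) (P : {set {set T}}) (D : {set T}) x :
  partition P D -> x \in D -> pblock P x \in P /\ x \in pblock P x.
Proof.
move=> /cover_partition covP xD.
by split; [apply: pblock_mem | rewrite mem_pblock]; rewrite covP.
Qed.

(** * Counting in a transversal design *)

Section TransversalDesign.
Variables (T : finType) (X : {set T}) (G L : {set {set T}}) (r s k lam : nat).
Hypothesis tdL : is_transversal_design r s k lam X G L.

Lemma transversal_card_points : #|X| = r * s.
Proof.
case: tdL => [[pG <- sG] _ _ _ _].
exact: card_uniform_partition sG pG.
Qed.

Lemma transversal_blockI C P x y : C \in L -> P \in G ->
  x \in C -> x \in P -> y \in C -> y \in P -> x = y.
Proof.
case: tdL => [_ _ _ blkL _] CL PG xC xP yC yP.
have [_ _ /(_ P PG) le1] := blkL C CL.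
by apply: (card_le1_eqP le1); rewrite inE ?xC ?yC.
Qed.

(** Double count of the pairs [(y, C)] with [x] and [y] in [C] and [y] outside the group [P] of [x].
    A block through [x] meets [P] only in [x], which leaves [k - 1] choices of [y]; each of the
    [(r - 1) * s] points outside [P] lies with [x] in [lam] blocks. *)
Lemma transversal_replication x : x \in X ->
  #|[set C in L | x \in C]| * (k - 1) = (r - 1) * s * lam.
Proof.
move=> xX; case: (tdL) => [[pG cG sG] _ _ blkL pairL].
have [PG xP] := partition_pblock_mem pG xX.
set P := pblock G x in PG xP.
have PX : P \subset X by rewrite -(cover_partition pG) (bigcup_max P).
transitivity (\sum_(y in X :\: P) \sum_(C in L) ((x \in C) && (y \in C) : nat)).
  rewrite exchange_big card_set_sum big_distrl /=; apply: eq_bigr => C CL.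
  case xC: (x \in C); last by rewrite mul0n big1.
  have [CX cC _] := blkL C CL.
  rewrite /= mul1n -card_set_sum -cC -(cardsID P C).
  have -> : C :&: P = [set x].
    apply/setP=> z; rewrite !inE; apply/andP/eqP => [[zC zP]|-> //].
    exact: (transversal_blockI CL PG zC zP xC xP).
  rewrite cards1 addKn; apply: eq_card => z; rewrite !inE.
  by case zC: (z \in C); rewrite ?andbF ?andbT // (subsetP CX _ zC) andbT.
transitivity (\sum_(y in X :\: P) lam).
  apply: eq_bigr => y /setDP[yX yP].
  have [QG yQ] := partition_pblock_mem pG yX.
  rewrite -card_set_sum; apply: (pairL P (pblock G y)) => //.
  by apply: contraNneq yP => ->.
rewrite sum_nat_const cardsD (setIidPr PX) transversal_card_points sG //.
by rewrite [in RHS]mulnBl mul1n.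
Qed.

(** Double count of the incident point-block pairs. *)
Lemma transversal_card_blocks n :
  (forall x, x \in X -> #|[set C in L | x \in C]| = n) ->
  #|L| * k = r * s * n.
Proof.
move=> reg; case: (tdL) => [_ _ _ blkL _].
transitivity (\sum_(C in L) \sum_(x in X) (x \in C : nat)).
  rewrite -sum_nat_const; apply: eq_bigr => C CL; have [CX <- _] := blkL C CL.
  rewrite -card_set_sum; apply: eq_card => x; rewrite inE andbC.
  by case: (boolP (x \in C)) => // /(subsetP CX).
rewrite exchange_big -transversal_card_points -sum_nat_const.
by apply: eq_bigr => x xX; rewrite -card_set_sum reg.
Qed.

End TransversalDesign.

(** * The constructed blocks: their slices and their faithful indexing *)

Section NewDesign.
Variables (T0 T1 : finType) (L0 : {set {set T0}}) (PP0 : {set {set {set T0}}}).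
Variables (L1 : {set {set T1}}) (psi : {set T1} -> {set {set T0}} -> T1).
Variables (L2 : {set {set {set T0}}}).
Variables (v0 k0 lam0 r s v1 lam1 k2 lam2 r2 : nat).
Hypothesis design0 : is_design 2 v0 k0 lam0 [set: T0] L0.
Hypothesis resolvable0 : is_resolution r s [set: T0] L0 PP0.
Hypothesis design1 : is_design 2 v1 r lam1 [set: T1] L1.
Hypothesis psi_bij : is_bijection_family PP0 L1 psi.
Hypothesis design2 : is_transversal_design r s k2 lam2 L0 PP0 L2.
Hypothesis r2E : forall x, x \in L0 -> #|[set C in L2 | x \in C]| = r2.

Local Notation nb := (new_block PP0 psi).

Lemma card_parallel_class P : P \in PP0 -> v0 = s * k0.
Proof.
case: resolvable0 => pPP _ res PPP; have [pP <-] := res P PPP.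
case: design0 => <- _ _ blk _.
apply: card_uniform_partition pP => B BP.
have BL : B \in L0 by rewrite -(cover_partition pPP); apply/bigcupP; exists P.
by case: (blk B BL).
Qed.

Lemma parallel_class_block P B : P \in PP0 -> B \in P -> B \in L0.
Proof.
case: resolvable0 => pPP _ _ PPP BP.
by rewrite -(cover_partition pPP); apply/bigcupP; exists P.
Qed.

Lemma mem_parallel_block P x : P \in PP0 ->
  pblock P x \in P /\ x \in pblock P x.
Proof.
case: resolvable0 => _ _ res /res[pP _].
exact: partition_pblock_mem pP (in_setT x).
Qed.

Lemma parallel_blockE P B x : P \in PP0 -> B \in P -> x \in B -> pblock P x = B.
Proof.
by case: resolvable0 => _ _ res /res[pP _]; apply: partition_pblock pP.
Qed.

Lemma psi_surj beta i : beta \in L1 -> i \in beta ->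
  exists2 P, P \in PP0 & i = psi beta P.
Proof.
case: psi_bij => bij _ /bij[_ psiE] ib.
by have /imsetP[P PPP ->] : i \in psi beta @: PP0; [rewrite psiE | exists P].
Qed.

Lemma mem_psi beta P : beta \in L1 -> P \in PP0 -> psi beta P \in beta.
Proof.
case: psi_bij => bij _ /bij[_ psiE] PPP.
by have := imset_f (psi beta) PPP; rewrite psiE.
Qed.

(** Injectivity of [psi beta] on the classes makes [P] the only class feeding the slice over
    [psi beta P], and [pblock P x] is the only block of [P] that can cover [x]. *)
Lemma mem_new_block beta gamma P x : beta \in L1 -> P \in PP0 ->
  ((x, psi beta P) \in nb beta gamma) = (pblock P x \in gamma).
Proof.
move=> bL PPP; have [bP xP] := mem_parallel_block x PPP.
apply/bigcupP/idP => [[j _ /bigcupP[Q /andP[QPP /eqP <-]]]|bg].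
  rewrite inE /= inE => /andP[/bigcupP[B /setIP[Bg BQ] xB] /eqP psiE].
  have /= eQ : P = Q by case: psi_bij => /(_ _ bL)[inj _] _; apply: inj.
  by rewrite (@parallel_blockE P B) ?eQ.
exists (psi beta P); first exact: mem_psi.
apply/bigcupP; exists P; first by rewrite PPP eqxx.
rewrite inE /= set11 andbT; apply/bigcupP; exists (pblock P x) => //.
by rewrite inE bg.
Qed.

Lemma mem_new_block_snd beta gamma x i : (x, i) \in nb beta gamma -> i \in beta.
Proof.
move=> /bigcupP[j jb /bigcupP[P _]].
by rewrite inE /= inE => /andP[_ /eqP ->].
Qed.

(** With [P] the class of [b], the slice over [psi beta P] contains a copy of [b]. Seen from
    [beta'], this slice comes from a class [Q] that [gamma'] meets at most once, so a single block
    of [Q] covers [b]; equal sizes make it [b] itself. Hence [P = Q], and [P] with its image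
    determines [beta]. *)
Lemma new_block_inj_aux beta gamma beta' gamma' b :
  beta \in L1 -> beta' \in L1 -> gamma \in L2 -> gamma' \in L2 ->
  nb beta gamma = nb beta' gamma' -> b \in gamma ->
  beta = beta' /\ b \in gamma'.
Proof.
move=> bL bL' gL gL' nbE bg; case: (resolvable0) => pPP _ _.
case: (design0) => _ /andP[k0gt1 _] _ blk _.
have bL0 : b \in L0.
  by case: design2 => _ _ _ /(_ _ gL)[gX _ _] _; apply: (subsetP gX).
have [_ cb] := blk b bL0.
have [PPP bP] := partition_pblock_mem pPP bL0; set P := pblock PP0 b in PPP bP.
have [x xb] : exists x, x \in b by apply/card_gt0P; rewrite cb ltnW.
have mem' y : y \in b -> (y, psi beta P) \in nb beta' gamma'.
  by move=> yb; rewrite -nbE mem_new_block // (parallel_blockE PPP bP yb).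
have [Q QPP psiE] := psi_surj bL' (mem_new_block_snd (mem' x xb)).
have slice y : y \in b -> pblock Q y \in gamma'.
  by move=> /mem'; rewrite psiE mem_new_block.
have [xQ xxQ] := mem_parallel_block x QPP.
have bE : b = pblock Q x.
  have [_ cQ] := blk _ (parallel_class_block QPP xQ).
  apply/eqP; rewrite eqEcard cQ cb leqnn andbT; apply/subsetP=> y yb.
  have [yQ yyQ] := mem_parallel_block y QPP.
  have xg := slice x xb.
  by rewrite (transversal_blockI design2 gL' QPP xg xQ (slice y yb) yQ).
have PQ : P = Q by apply: partition_pblock pPP QPP _; rewrite bE.
split; last by rewrite bE slice.
case: psi_bij => _ /(_ P (psi beta P) PPP)[b0 [_ uniq]].
by rewrite -(uniq beta) // -(uniq beta') // psiE PQ.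
Qed.

Lemma new_block_inj : {in setX L1 L2 &, injective (fun p => nb p.1 p.2)}.
Proof.
case: (design2) => _ /andP[k2gt1 _] _ blk2 _.
move=> [beta gamma] [beta' gamma'] /setXP[/= bL gL] /setXP[/= bL' gL'] nbE.
have [[_ cg _] [_ cg' _]] := (blk2 _ gL, blk2 _ gL').
(* Recovering [beta] requires some element of [gamma]; for [gamma] itself one inclusion suffices,
   both sets having [k2] elements. *)
have [b bg] : exists b, b \in gamma by apply/card_gt0P; rewrite cg ltnW.
have [-> _] := new_block_inj_aux bL bL' gL gL' nbE bg.
congr (_, _); apply/eqP; rewrite eqEcard cg cg' leqnn andbT.
apply/subsetP=> c /(new_block_inj_aux bL bL' gL gL' nbE) [].
by [].
Qed.

Lemma new_blocksE :
  new_blocks PP0 L1 psi L2 = [set nb p.1 p.2 | p in setX L1 L2].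
Proof.
apply/setP=> B; apply/bigcupP/imsetP => [[beta bL /imsetP[gamma gL ->]]|].
  by exists (beta, gamma); rewrite ?inE /= ?bL.
by move=> [[beta gamma] /setXP[bL gL] ->]; exists beta => //; apply: imset_f.
Qed.

Lemma card_new_blocks : #|new_blocks PP0 L1 psi L2| = #|L1| * #|L2|.
Proof. by rewrite new_blocksE (card_in_imset new_block_inj) cardsX. Qed.

(** * Block size and numbers of blocks through points and pairs *)

Lemma count_new_blocks (p : pred {set T0 * T1}) :
  #|[set B in new_blocks PP0 L1 psi L2 | p B]| =
  \sum_(beta in L1) #|[set gamma in L2 | p (nb beta gamma)]|.
Proof.
rewrite card_set_sum new_blocksE big_imset /=; last exact: new_block_inj.
under [RHS]eq_bigr do rewrite card_set_sum.
by rewrite pair_big; apply: eq_bigl => -[beta gamma]; rewrite inE.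
Qed.

(** Slicing by the second coordinate and reindexing the slices by classes through [psi beta] leaves
    [k0] points for each of the [k2] elements of [gamma]. *)
Lemma card_new_block beta gamma : beta \in L1 -> gamma \in L2 ->
  #|nb beta gamma| = k0 * k2.
Proof.
move=> bL gL; case: (resolvable0) => pPP _ res; case: (psi_bij) => bij _.
have [inj psiE] := bij _ bL.
case: (design0) => _ _ _ blk _.
transitivity (\sum_(i in beta) \sum_x ((x, i) \in nb beta gamma : nat)).
  rewrite exchange_big pair_big_dep /= -sum1_card big_mkcond [RHS]big_mkcond.
  apply: eq_bigr => -[x i] _ /=; case: ifP => [/mem_new_block_snd -> //|_].
  by case: ifP.
transitivity
  (\sum_(i in psi beta @: PP0) \sum_x ((x, i) \in nb beta gamma : nat)).
  by rewrite psiE.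
rewrite big_imset //=.
transitivity (\sum_(P in PP0) \sum_(b in P) (b \in gamma) * k0).
  apply: eq_bigr => P PPP; have [pP _] := res P PPP.
  transitivity (\sum_(x in [set: T0]) (pblock P x \in gamma : nat)).
    by apply: eq_big => x; rewrite ?inE // mem_new_block.
  rewrite (set_partition_big _ pP) /=; apply: eq_bigr => b bP.
  have [_ <-] := blk b (parallel_class_block PPP bP).
  rewrite mulnC -sum_nat_const; apply: eq_bigr => x xb.
  by rewrite (parallel_blockE PPP bP xb).
rewrite -(set_partition_big _ pPP) /= -big_distrl /= mulnC; congr (_ * _).
case: design2 => _ _ _ /(_ _ gL)[gX <- _] _.
rewrite -card_set_sum; apply: eq_card => b; rewrite inE andbC.
by case: (boolP (b \in gamma)) => // /(subsetP gX).
Qed.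

(* For fixed [i], the pairs [(beta, P)] with [psi beta P = i] match the
   parallel classes one to one, so a sum over [beta] becomes a sum over [P]. *)
Lemma count_same_coord x y i :
  #|[set B in new_blocks PP0 L1 psi L2 | ((x, i) \in B) && ((y, i) \in B)]| =
  \sum_(P in PP0)
    #|[set gamma in L2 | (pblock P x \in gamma) && (pblock P y \in gamma)]|.
Proof.
case: (psi_bij) => bij uniq.
pose F P :=
  #|[set gamma in L2 | (pblock P x \in gamma) && (pblock P y \in gamma)]|.
rewrite (count_new_blocks (fun B => ((x, i) \in B) && ((y, i) \in B))).
transitivity (\sum_(beta in L1) \sum_(P in PP0 | psi beta P == i) F P).
  apply: eq_bigr => beta bL; case: (boolP (i \in beta)) => [ib|inb].
    have [P PPP ->] := psi_surj bL ib; have [inj _] := bij _ bL.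
    rewrite (big_pred1 P) => [|Q].
      by apply: eq_card => gamma; rewrite !inE !mem_new_block.
    apply/andP/eqP => [[QPP /eqP]|-> //]; first exact: inj.
  rewrite [RHS]big1 => [|P /andP[PPP /eqP psiE]]; last first.
    by rewrite -psiE mem_psi in inb.
  apply/eqP; rewrite cards_eq0; apply/eqP/setP=> gamma; rewrite !inE.
  apply: contraNF inb => /andP[_ /andP[+ _]]; exact: mem_new_block_snd.
under eq_bigr do rewrite big_mkcondr.
rewrite exchange_big; apply: eq_bigr => P PPP /=.
have [beta [[bL psiE] bU]] := uniq P i PPP.
rewrite -big_mkcondr (big_pred1 beta) // => beta'.
apply/andP/eqP => [[bL' /eqP e]|->]; last by rewrite psiE eqxx.
exact/esym/bU.
Qed.

Lemma new_design_replication x i :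
  #|[set B in new_blocks PP0 L1 psi L2 | (x, i) \in B]| = r * r2.
Proof.
(* The condition is doubled so that the pair count applies with [y = x]. *)
transitivity #|[set B in new_blocks PP0 L1 psi L2 |
                 ((x, i) \in B) && ((x, i) \in B)]|.
  by apply: eq_card => B; rewrite !inE andbb.
case: (resolvable0) => _ <- _; rewrite count_same_coord -sum_nat_const.
apply: eq_bigr => P PPP; have [bP _] := mem_parallel_block x PPP.
rewrite -(r2E (parallel_class_block PPP bP)).
by apply: eq_card => B; rewrite !inE andbb.
Qed.

Lemma new_design_pair_same_coord x y i : x != y ->
  #|[set B in new_blocks PP0 L1 psi L2 | ((x, i) \in B) && ((y, i) \in B)]| =
  lam0 * r2.
Proof.
move=> xy; case: (resolvable0) => pPP _ _.
case: (design0) => _ _ _ _ /(_ [set x; y] (subsetT _)).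
rewrite cards2 xy => /(_ erefl) <-.
rewrite count_same_coord card_set_sum (set_partition_big _ pPP) /=.
rewrite big_distrl /=.
apply: eq_bigr => P PPP.
have [[bP xb] [cP yc]] := (mem_parallel_block x PPP, mem_parallel_block y PPP).
(* Only one block of [P] contains [x], so this sum is the indicator of [x] and [y] sharing a block
   of [P]. *)
have -> : \sum_(B in P) ([set x; y] \subset B : nat) =
          (pblock P x == pblock P y).
  rewrite (bigD1 _ bP) /= big1 ?addn0 => [|B /andP[BP]].
    congr nat_of_bool; rewrite subUset !sub1set xb /=.
    by apply/idP/eqP => [/(parallel_blockE PPP bP)|->].
  rewrite subUset sub1set; case: (boolP (x \in B)) => //= xB.
  by rewrite (parallel_blockE PPP BP xB) eqxx.
case: eqVneq => [<-|neq].
  rewrite mul1n -(r2E (parallel_class_block PPP bP)).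
  by apply: eq_card => B; rewrite !inE andbb.
rewrite mul0n; apply/eqP; rewrite cards_eq0; apply/eqP/setP=> g; rewrite !inE.
apply: contraNF neq => /and3P[gL xg yg].
by rewrite (transversal_blockI design2 gL PPP xg bP yg cP).
Qed.

Lemma new_design_pair_diff_coord x y i j : i != j ->
  #|[set B in new_blocks PP0 L1 psi L2 | ((x, i) \in B) && ((y, j) \in B)]| =
  lam1 * lam2.
Proof.
move=> ij; case: (design1) => _ _ _ _ /(_ [set i; j] (subsetT _)).
rewrite cards2 ij => /(_ erefl) <-.
rewrite (count_new_blocks (fun B => ((x, i) \in B) && ((y, j) \in B))).
rewrite card_set_sum big_distrl; apply: eq_bigr => beta bL /=.
rewrite subUset !sub1set; case: (boolP ((i \in beta) && (j \in beta))).
  case/andP=> /(psi_surj bL)[P PPP iE] /(psi_surj bL)[Q QPP jE].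
  have [[bP _] [cQ _]] := (mem_parallel_block x PPP, mem_parallel_block y QPP).
  have PQ : P != Q by apply: contraNneq ij => PQ; rewrite iE jE PQ.
  case: design2 => _ _ _ _ /(_ P Q _ _ PPP QPP PQ bP cQ) <-; rewrite mul1n.
  by apply: eq_card => g; rewrite !inE iE jE !mem_new_block.
move=> nij; rewrite mul0n; apply/eqP; rewrite cards_eq0.
apply/eqP/setP=> g; rewrite !inE; apply: contraNF nij => /and3P[_].
by move=> /mem_new_block_snd-> /mem_new_block_snd->.
Qed.

(** * Parameters of the constructed design *)

Lemma new_blocks_size B : B \in new_blocks PP0 L1 psi L2 -> #|B| = k0 * k2.
Proof.
by move=> /bigcupP[beta bL /imsetP[gamma gL ->]]; apply: card_new_block.
Qed.

Lemma exists_parallel_class : exists P, P \in PP0.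
Proof.
apply/card_gt0P; case: resolvable0 => _ -> _.
by case: design2 => _ /andP[k2gt1 le] _ _ _; apply: leq_trans le; apply: ltnW.
Qed.

Lemma design0_card_points : v0 = s * k0.
Proof. by have [P] := exists_parallel_class; apply: card_parallel_class. Qed.

Lemma mul_r2 : r2 * (k2 - 1) = (r - 1) * s * lam2.
Proof.
have [P PPP] := exists_parallel_class.
have [x _] : exists x, x \in [set: T0].
  by apply/card_gt0P; case: design0 => -> /andP[]; lia.
have [bP _] := mem_parallel_block x PPP.
have bL := parallel_class_block PPP bP.
by rewrite -(r2E bL) (transversal_replication design2).
Qed.

(** Gives the positive index of the 1-design and, later, the existence of a block. Here [0 < s]
    because [v0 = s * k0] is positive. *)
Lemma r2_gt0 : 0 < r2.
Proof.
case: design0 => _ /andP[k0gt1 lek0] _ _ _.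
case: design2 => _ /andP[k2gt1 lek2] lam2gt0 _ _.
have sgt0 : 0 < s.
  by move: k0gt1 lek0; rewrite design0_card_points; case: (s) => //; lia.
have : 0 < r2 * (k2 - 1).
  by rewrite mul_r2 !muln_gt0 sgt0 lam2gt0 subn_gt0 (leq_trans k2gt1).
by rewrite muln_gt0 => /andP[].
Qed.

Lemma new_design_1design :
  is_design 1 (v0 * v1) (k0 * k2) (r * r2) [set: T0 * T1]
    (new_blocks PP0 L1 psi L2).
Proof.
case: (design0) => cT0 /andP[k0gt1 lek0] _ _ _.
case: (design1) => cT1 /andP[_ lev1] _ _ _.
case: (design2) => _ /andP[k2gt1 lek2] _ _ _.
split=> [| | |B /new_blocks_size -> //|S _ /eqP/cards1P[[x i] ->]].
- by rewrite cardsT card_prod -!cardsT cT0 cT1.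
- rewrite muln_gt0 leq_mul ?(leq_trans lek2) // andbT.
  by rewrite (ltnW k0gt1) ltnW.
- by rewrite muln_gt0 r2_gt0 andbT (leq_trans _ lek2) // ltnW.
rewrite -(new_design_replication x i).
by apply: eq_card => B; rewrite !inE sub1set.
Qed.

(** Each 2-subset has either equal or distinct second coordinates. Both [T0] and [T1] have at least
    two points, so the two kinds of pairs with known counts do occur and force the value of [t]. *)
Lemma new_design_2designP t :
  is_design 2 (v0 * v1) (k0 * k2) t [set: T0 * T1] (new_blocks PP0 L1 psi L2)
  <-> lam0 * r2 = t /\ lam1 * lam2 = t.
Proof.
case: (design0) => cT0 /andP[k0gt1 lek0] lam0gt0 _ _.
case: (design1) => cT1 /andP[rgt1 lev1] lam1gt0 _ _.
case: (design2) => _ /andP[k2gt1 lek2] lam2gt0 _ _.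
have pairE (p q : T0 * T1) :
    #|[set B in new_blocks PP0 L1 psi L2 | [set p; q] \subset B]| =
    #|[set B in new_blocks PP0 L1 psi L2 | (p \in B) && (q \in B)]|.
  by apply: eq_card => B; rewrite !inE subUset !sub1set.
split=> [[_ _ _ _ Ht]|[same diff]].
  have /card_gt1P[x [y [_ _ xy]]] : 1 < #|[set: T0]|.
    by rewrite cT0 (leq_trans k0gt1).
  have /card_gt1P[i [j [_ _ ij]]] : 1 < #|[set: T1]|.
    by rewrite cT1 (leq_trans rgt1).
  split.
    rewrite -(new_design_pair_same_coord i xy) -pairE Ht // cards2.
    by rewrite xpair_eqE negb_and xy.
  rewrite -(new_design_pair_diff_coord x y ij) -pairE Ht // cards2.
  by rewrite xpair_eqE negb_and ij orbT.
split=> [| | |B /new_blocks_size -> //|S _ /eqP/cards2P[[x i] [[y j] [pq ->]]]].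
- by rewrite cardsT card_prod -!cardsT cT0 cT1.
- by rewrite leq_mul ?(leq_trans lek2) // andbT (leq_mul k0gt1 (ltnW k2gt1)).
- by rewrite -diff muln_gt0 lam1gt0.
rewrite pairE; case: (eqVneq i j) pq => [->|ij _]; last first.
  by rewrite new_design_pair_diff_coord.
rewrite xpair_eqE negb_and eqxx orbF => xy.
by rewrite new_design_pair_same_coord.
Qed.

End NewDesign.

(** * Clearing the denominator in (c), and the final assembly *)

Lemma rat_eq_mul_div (a b d e n : nat) : 0 < e -> 1 < n ->
  ((a%:R = b%:R * ((e%:R - 1) * d%:R / (n%:R - 1)) :> rat)%R <->
   a * (n - 1) = b * ((e - 1) * d)).
Proof.
move=> egt0 ngt1.
have nz : ((n - 1)%:R != 0 :> rat)%R.
  by rewrite Num.Theory.pnatr_eq0 -lt0n subn_gt0.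
(* As [e] and [n] are at least 1, truncated and rational subtraction of 1 agree. *)
rewrite -(GRing.natrB _ egt0) -(GRing.natrB _ (ltnW ngt1)).
rewrite GRing.mulrA -!GRing.natrM; split=> [E|E].
  apply/eqP; rewrite -(Num.Theory.eqr_nat rat) GRing.natrM E.
  by rewrite GRing.divfK.
by apply: (canRL (GRing.mulfK nz)); rewrite -GRing.natrM E.
Qed.

Theorem theorem3p2 (T0 T1 : finType)
  (L0 : {set {set T0}}) (PP0 : {set {set {set T0}}})
  (L1 : {set {set T1}})
  (psi : {set T1} -> {set {set T0}} -> T1)
  (L2 : {set {set {set T0}}})
  (v0 k0 lam0 r s v1 lam1 k2 lam2 b2 r2 : nat)
  (design0 : is_design 2 v0 k0 lam0 [set: T0] L0)
  (resolvable0 : is_resolution r s [set: T0] L0 PP0)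
  (design1 : is_design 2 v1 r lam1 [set: T1] L1)
  (symmetric1 : symmetric_design [set: T1] L1)
  (psi_bij : is_bijection_family PP0 L1 psi)
  (design2 : is_transversal_design r s k2 lam2 L0 PP0 L2)
  (b2E : #|L2| = b2)
  (r2E : forall x, x \in L0 -> #|[set C in L2 | x \in C]| = r2) :
  let D := [set: T0 * T1] in
  let B := new_blocks PP0 L1 psi L2 in
  [/\ (* (a) *)
      is_design 1 (v0 * v1) (k0 * k2) (r * r2) D B /\ #|B| = v1 * b2,
      (* (b) *)
      symmetric_design D B <-> r * (r - 1) * s * lam2 = k0 * k2 * (k2 - 1)
    & (* (c) *)
      let c := (lam1%:R = lam0%:R * ((r%:R - 1) * s%:R / (k2%:R - 1)) :> rat)%R
      in (is_2design D B <-> c) /\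
         (c -> is_design 2 (v0 * v1) (k0 * k2) (lam1 * lam2) D B)].
Proof.
move=> D B; have [_ /andP[k0gt1 lek0] _ _ _] := design0.
have [cT1 /andP[rgt1 lev1] _ _ _] := design1.
have [_ /andP[k2gt1 lek2] lam2gt0 _ _] := design2.
have r2M := mul_r2 design0 resolvable0 design2 r2E.
have v0E := design0_card_points design0 resolvable0 design2.
have b2M : b2 * k2 = r * s * r2.
  by rewrite -b2E (transversal_card_blocks design2 r2E).
have cB : #|B| = v1 * b2.
  rewrite (card_new_blocks design0 resolvable0 psi_bij design2).
  by rewrite symmetric1 cT1 b2E.
have D1 := new_design_1design design0 resolvable0 design1 psi_bij design2 r2E.
have D2 := new_design_2designP design0 resolvable0 design1 psi_bij design2 r2E.
have [cD _ _ blkB _] := D1.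
have sgt0 : 0 < s by move: k0gt1 lek0; rewrite v0E; case: (s) => //; lia.
have k2m : 0 < k2 - 1 by rewrite subn_gt0.
split=> //.
  (* The right side is [s] times the left side of (b). Symmetry reads [v1 * b2 = s * k0 * v1], so
     (b) follows by cancelling the positive factors [v1], [s] and [k2 * (k2 - 1)]. *)
  have b2K : b2 * (k2 * (k2 - 1)) = s * (r * (r - 1) * s * lam2).
    by rewrite mulnA b2M -mulnA r2M; ring.
  rewrite /symmetric_design cB cD mulnC.
  have v1gt0 : 0 < v1 by rewrite (leq_trans _ lev1) // ltnW.
  have kk : 0 < k2 * (k2 - 1) by rewrite muln_gt0 k2m ltnW.
  split=> E.
    apply/eqP; rewrite -(eqn_pmul2l sgt0) -b2K.
    by move/eqP: E; rewrite eqn_pmul2r // => /eqP ->; rewrite v0E -!mulnA.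
  congr (_ * _); apply/eqP; rewrite -(eqn_pmul2r kk) b2K E v0E.
  by rewrite -!mulnA.
move=> c.
(* Multiplied by [k2 - 1], the equality of the two pair counts becomes [lam2] times the cleared form
   of [c]; both factors are positive. *)
have cE : c <-> lam0 * r2 = lam1 * lam2.
  rewrite /c rat_eq_mul_div //; last exact: ltnW.
  split=> E; apply/eqP.
    by rewrite -(eqn_pmul2r k2m) -mulnA r2M mulnA -E mulnAC.
  by rewrite -(eqn_pmul2r lam2gt0) mulnAC -E -mulnA r2M -!mulnA.
have c2 : c -> is_design 2 (v0 * v1) (k0 * k2) (lam1 * lam2) D B.
  by move/cE=> E; apply/D2.
split=> //; split=> [[v [k [t dB]]]|/c2 ?]; last first.
  by exists (v0 * v1), (k0 * k2), (lam1 * lam2).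
have [cD' _ _ blkB' _] := dB.
(* The unknown [v] and [k] are forced: [v] is the number of points and [k] the size of any block, so
   one block must be exhibited. *)
apply/cE; suff /D2[-> ->] : is_design 2 (v0 * v1) (k0 * k2) t D B by [].
have [B0 B0B] : exists B0, B0 \in B.
  apply/card_gt0P; rewrite cB muln_gt0 (leq_trans _ lev1) ?(ltnW rgt1) //.
  have : 0 < b2 * k2.
    rewrite b2M !muln_gt0 sgt0 (ltnW rgt1).
    by rewrite (r2_gt0 design0 resolvable0 design2 r2E).
  by rewrite muln_gt0 => /andP[].
have [_ kE] := blkB _ B0B; have [_ kE'] := blkB' _ B0B.
by rewrite -cD -kE kE' cD'.
Qed.
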